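(* Let $M$ be a left $R$-module which is a self-progenerator in $\sigma[M]$, and assume that $\Lambda^{fi}(M)$ is compact. The following conditions are equivalent: (a) $M$ is strongly harmonic. (b) $\Lambda^{fi}(M)$ is a normal idiom. (c) For each $N\in\Lambda^{fi}(M)$ and $\mathcal{M}\in Max^{fi}(M)$: $Ler(N)\leq\mathcal{M}\Leftrightarrow N\leq\mathcal{M}$. (d) $Ler\colon\Lambda^{fi}(M)\to\Lambda^{fi}(M)$ is $\sum$-preserving, i.e. $Ler(\sum_IN_i)=\sum_ILer(N_i)$ for every family $\{N_i\}_I\subseteq\Lambda^{fi}(M)$ (equivalently, $Ler$ has a right adjoint). (e) For each $N,L\in\Lambda^{fi}(M)$: $N+L=M\Rightarrow Ler(N)+Ler(L)=M$.
   Context: $R$ is an associative ring with identity; modules are unital left $R$-modules. A submodule $N\leq M$ is fully invariant if $f(N)\subseteq N$ for all $f\in\mathrm{End}_R(M)$; $\Lambda^{fi}(M)$ is the complete lattice of fully invariant submodules of $M$ ordered by inclusion, and $Max^{fi}(M)$ is the set of its coatoms (maximal proper elements). $\sigma[M]$ is the full subcategory of $R$-Mod of all modules that embed in a quotient of some direct sum $M^{(X)}$. $M$ is $N$-projective if for every epimorphism $\rho\colon N\to X$ and every homomorphism $\alpha\colon M\to X$ there is $\beta\colon M\to N$ with $\rho\beta=\alpha$; $M$ is projective in $\sigma[M]$ if it is $N$-projective for every $N\in\sigma[M]$. $M$ is a self-progenerator in $\sigma[M]$ if it is projective in $\sigma[M]$ and every submodule of $M$ is $M$-generated (a quotient of some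 $M^{(X)}$). For $N,L\leq M$ put $N_ML=\sum\{f(N)\mid f\in\mathrm{Hom}_R(M,L)\}$. For $K\leq M$ put $\mathrm{Ann}_M(K)=\bigcap\{\ker f\mid f\in\mathrm{Hom}_R(M,K)\}$. $M$ is strongly harmonic if for every two distinct $N,L\in Max^{fi}(M)$ there exist $N',L'\in\Lambda^{fi}(M)$ with $L'\nleq L$, $N'\nleq N$ and $L'_MN'=0$. $\Lambda^{fi}(M)$ is normal if for all $A,B\in\Lambda^{fi}(M)$ with $A+B=M$ there exist $A',B'\in\Lambda^{fi}(M)$ with $A+B'=M=A'+B$ and $A'_MB'=0$. $\Lambda^{fi}(M)$ is compact if whenever $M=\sum_{i\in I}N_i$ with all $N_i\in\Lambda^{fi}(M)$, there is a finite $F\subseteq I$ with $M=\sum_{i\in F}N_i$. The operator $Ler\colon\Lambda^{fi}(M)\to\Lambda^{fi}(M)$ is $Ler(N)=\{m\in M\mid N+\mathrm{Ann}_M(Rm)=M\}$. *)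

(* Defs.v *)
From HB Require Import structures.
From mathcomp Require Import all_boot all_order all_algebra.
From mathcomp Require Import mathcomp_extra boolp classical_sets functions.
From mathcomp Require Import cardinality.

Set Implicit Arguments.
Unset Strict Implicit.
Unset Printing Implicit Defensive.

Import GRing.Theory.
Local Open Scope classical_set_scope.
Local Open Scope ring_scope.

(* The direct sum M^(X): finitely supported functions from X to M, as a
   submodule of the module X -> M of all functions. *)
Definition fin_supp (R : pzRingType) (M : lmodType R) (X : Type) :
    {pred (X -> M)} :=
  fun f => `[< finite_set [set x | f x != 0] >].

Lemma fin_supp_submod_closed (R : pzRingType) (M : lmodType R) (X : Type) :
  submod_closed (@fin_supp R M X).
Proof.
split=> [|a f g /asboolP f_fin /asboolP g_fin]; apply/asboolP.
  by apply: sub_finite_set (@finite_set0 X) => x /=; rewrite eqxx.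
have fg_fin : finite_set ([set x | f x != 0] `|` [set x | g x != 0]).
  by rewrite finite_setU.
apply: sub_finite_set fg_fin => x /=.
case: (eqVneq (f x) 0) => [fx0|]; last by left.
case: (eqVneq (g x) 0) => [gx0|]; last by right.
by rewrite [X in X != 0](_ : _ = a *: f x + g x)// fx0 gx0 scaler0 addr0 eqxx.
Qed.

Record dsum (R : pzRingType) (M : lmodType R) (X : Type) := DSum {
  dsum_fun :> X -> M;
  _ : dsum_fun \in @fin_supp R M X
}.

HB.instance Definition _ (R : pzRingType) (M : lmodType R) (X : Type) :=
  [isSub for @dsum_fun R M X].
HB.instance Definition _ (R : pzRingType) (M : lmodType R) (X : Type) :=
  [Choice of dsum M X by <:].
HB.instance Definition _ (R : pzRingType) (M : lmodType R) (X : Type) :=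
  GRing.SubChoice_isSubLmodule.Build R (X -> M) (@fin_supp R M X) (dsum M X)
    (@fin_supp_submod_closed R M X).

(* N is an object of sigma[M]; the quotient of M^(X) is given by a surjective
   linear map onto Q. *)
Definition in_sigma (R : pzRingType) (M N : lmodType R) : Prop :=
  exists (X : Type) (Q : lmodType R)
         (p : {linear dsum M X -> Q}) (i : {linear N -> Q}),
    range p = setT /\ injective i.

Definition relatively_projective (R : pzRingType) (M N : lmodType R) : Prop :=
  forall (X : lmodType R) (rho : {linear N -> X}) (alpha : {linear M -> X}),
    range rho = setT ->
    exists beta : {linear M -> N}, rho \o beta =1 alpha.

Definition projective_in_sigma (R : pzRingType) (M : lmodType R) : Prop :=
  forall N : lmodType R, in_sigma M N -> relatively_projective M N.

(* A homomorphism into a submodule K of M is represented by its composite with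
   the inclusion of K in M, here and in hom_into. *)
Definition generated_by (R : pzRingType) (M : lmodType R) (K : set M) : Prop :=
  exists (X : Type) (p : {linear dsum M X -> M}), range p = K.

Definition is_submodule (R : pzRingType) (M : lmodType R) (N : set M) : Prop :=
  submod_closed (mem N).

Definition self_progenerator (R : pzRingType) (M : lmodType R) : Prop :=
  projective_in_sigma M /\ (forall K : set M, is_submodule K -> generated_by K).

Definition hom_into (R : pzRingType) (M : lmodType R) (L : set M) :
    set {linear M -> M} :=
  [set f | range f `<=` L].

Definition sub_add (R : pzRingType) (M : lmodType R) (N L : set M) : set M :=
  [set x + y | x in N & y in L].

(* The sum of the submodules N i for i in D, i.e. the finite sums of elements
   of their union; it is the zero submodule when D is empty. *)
Definition sub_sum (R : pzRingType) (M : lmodType R) (I : Type) (D : set I)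
    (N : I -> set M) : set M :=
  [set \sum_(x <- s) x |
    s in [set s : seq M | forall x, x \in s -> (\bigcup_(i in D) N i) x]].

(* N_M L *)
Definition sub_prod (R : pzRingType) (M : lmodType R) (N L : set M) : set M :=
  sub_sum (hom_into L) (fun f => f @` N).

(* Ann_M(K) *)
Definition sub_ann (R : pzRingType) (M : lmodType R) (K : set M) : set M :=
  \bigcap_(f in hom_into K) (f @^-1` [set 0]).

Definition cyclic_sub (R : pzRingType) (M : lmodType R) (m : M) : set M :=
  range (fun a : R => a *: m).

Definition Lfi (R : pzRingType) (M : lmodType R) : set (set M) :=
  [set N | is_submodule N /\ forall f : {linear M -> M}, f @` N `<=` N].

Definition Maxfi (R : pzRingType) (M : lmodType R) : set (set M) :=
  [set N | [/\ Lfi N, N <> setT &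
             forall K, Lfi K -> N `<=` K -> K = N \/ K = setT]].

Definition strongly_harmonic (R : pzRingType) (M : lmodType R) : Prop :=
  forall N L : set M, Maxfi N -> Maxfi L -> N <> L ->
    exists N' L' : set M,
      [/\ Lfi N', Lfi L', ~ (L' `<=` L), ~ (N' `<=` N) &
          sub_prod L' N' = [set 0]].

(* An idiom is a complete, modular, upper-continuous lattice. In Lfi M joins
   are sums and meets are intersections. *)
Definition Lfi_idiom (R : pzRingType) (M : lmodType R) : Prop :=
  [/\ forall (I : Type) (N : I -> set M), (forall i, Lfi (N i)) ->
        Lfi (sub_sum setT N) /\ Lfi (\bigcap_i N i),
      forall A B C : set M, Lfi A -> Lfi B -> Lfi C -> A `<=` C ->
        sub_add A B `&` C = sub_add A (B `&` C)
    & forall (A : set M) (D : set (set M)), Lfi A -> D `<=` @Lfi R M ->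
        D !=set0 ->
        (forall X Y, D X -> D Y -> exists Z, [/\ D Z, X `<=` Z & Y `<=` Z]) ->
        A `&` sub_sum D id = sub_sum D (fun X => A `&` X)].

Definition Lfi_normal (R : pzRingType) (M : lmodType R) : Prop :=
  forall A B : set M, Lfi A -> Lfi B -> sub_add A B = setT ->
    exists A' B' : set M,
      [/\ Lfi A', Lfi B', sub_add A B' = setT, sub_add A' B = setT &
          sub_prod A' B' = [set 0]].

Definition Lfi_compact (R : pzRingType) (M : lmodType R) : Prop :=
  forall (I : Type) (N : I -> set M), (forall i, Lfi (N i)) ->
    sub_sum setT N = setT ->
    exists2 F : set I, finite_set F & sub_sum F N = setT.

Definition Ler (R : pzRingType) (M : lmodType R) (N : set M) : set M :=
  [set m | sub_add N (sub_ann (cyclic_sub m)) = setT].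

Definition Ler_sum_preserving (R : pzRingType) (M : lmodType R) : Prop :=
  forall (I : Type) (N : I -> set M), (forall i, Lfi (N i)) ->
    Ler (sub_sum setT N) = sub_sum setT (fun i => Ler (N i)).

Definition Ler_has_right_adjoint (R : pzRingType) (M : lmodType R) : Prop :=
  exists2 G : set M -> set M, (forall K, Lfi K -> Lfi (G K)) &
    forall N K : set M, Lfi N -> Lfi K -> (Ler N `<=` K <-> N `<=` G K).

(* Main.v *)
Require Import Defs.
From HB Require Import structures.
From mathcomp Require Import all_boot all_algebra.
From mathcomp Require Import finmap.
From mathcomp Require Import boolp classical_sets.
From mathcomp Require Import cardinality fsbigop.

Set Implicit Arguments.
Unset Strict Implicit.
Unset Printing Implicit Defensive.

Import GRing.Theory.
Local Open Scope classical_set_scope.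
Local Open Scope ring_scope.

(** Write A + B for the sum of two fully invariant submodules and Ann for
    Ann_M. Everything rests on one consequence of the hypothesis on M: if a
    submodule K of M is the sum of the images of some endomorphisms h of M, then
    each f : M -> K is, at every point, a finite sum of values of maps h o b
    with b in End(M) [lift_sum]. To see this, lift f along the map from the
    direct sum of copies of M onto K that is h on the copy indexed by h. Since
    every submodule is the sum of the images of the homomorphisms from M into
    it, three facts follow:
    - Ann of a sum is the intersection of the annihilators [sub_ann_sum];
    - a submodule and its fully invariant closure have the same annihilator
      [sub_ann_closure];
    - if N + A = M and N + B = M then N + (A `&` B) = M [comaximal_setI].
      Indeed, write an element b of B as a sum of values h(b), where h maps M
      into N or into A; full invariance of B puts the latter values in A `&` B.

    Hence Ler(N) is the directed union of those fully invariant C for which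
    N + Ann(C) = M [LerE]. In particular Ler(N) is fully invariant, and it lies
    in N because m is a sum of values of maps M -> Rm, which kill Ann(Rm).
    Compactness is used in two ways: every proper fully invariant submodule lies
    in a maximal one, and if B plus a directed union is M then B plus one member
    of the family is already M.

    With Ler as a directed union, the second use of compactness turns normality
    into the single condition
          A + B = M  implies  A + Ler(B) = M                   [normal_Ler],
    from which the cycle of implications is short.

    (a) implies (b): if A + Ler(B) lies in a maximal N, consider the directed
    union of the annihilators Ann(Y) over the Y not contained in N (directed
    because N is prime for intersections, by comaximality). No maximal L above B
    contains it: A + B = M forces L <> N, and strong harmonicity provides L'
    outside L annihilating some N' outside N. So B + Ann(Y) = M for one such Y,
    which puts Y inside Ler(B), hence inside N, a contradiction.

    (b) implies (c): if N is not in the maximal Mx then Mx + N = M, so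
    Mx + Ler(N) = M. (c) implies (d): for m in Ler(sum N_i), no maximal element
    contains both sum Ler(N_i) and Ann(Rm), so m lies in Ler(sum Ler(N_i)),
    which is contained in sum Ler(N_i). Sum-preservation gives the right adjoint
    K |-> sum of the N with Ler(N) in K, and an adjoint gives (e) because
    Ler(M) = M. Finally, given (e) and distinct maximal N and L, Ler(L) is not
    contained in N, so some C with L + Ann(C) = M is not contained in N, and the
    pair (C, Ann(C)) witnesses (a). *)

(** * Submodules and their sums *)

Lemma is_submoduleP (R : pzRingType) (M : lmodType R) (K : set M) :
  is_submodule K <->
  K 0 /\ forall (a : R) (x y : M), K x -> K y -> K (a *: x + y).
Proof.
split=> [[K0 KP]|[K0 KP]]; split.
- by move: K0; rewrite inE.
- move=> a x y Kx Ky; have := KP a x y; rewrite !inE; exact.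
- by rewrite inE.
- by move=> a x y; rewrite !inE; apply: KP.
Qed.

Section Submodules.
Variables (R : pzRingType) (M : lmodType R).
Implicit Types (K L N A B C : set M) (x y m : M).

Lemma submod0 K : is_submodule K -> K 0.
Proof. by case/is_submoduleP. Qed.

Lemma submodD K x y : is_submodule K -> K x -> K y -> K (x + y).
Proof. by case/is_submoduleP=> _ KP Kx Ky; rewrite -[x]scale1r; apply: KP. Qed.

Lemma submodZ K (a : R) x : is_submodule K -> K x -> K (a *: x).
Proof.
by case/is_submoduleP=> K0 KP Kx; rewrite -[_ *: _]addr0; apply: KP.
Qed.

Lemma submodB K x y : is_submodule K -> K x -> K y -> K (x - y).
Proof.
by move=> subK Kx Ky; apply: submodD => //; rewrite -scaleN1r; apply: submodZ.
Qed.

Lemma sub_sum_least (I : Type) (D : set I) (N : I -> set M) K :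
  is_submodule K -> (forall i, D i -> N i `<=` K) -> sub_sum D N `<=` K.
Proof.
move=> subK NK _ [s sN <-]; elim: s sN => [|x s IHs] sN.
  by rewrite big_nil; apply: submod0.
rewrite big_cons; apply: submodD => //.
  by have [i Di] := sN x (mem_head _ _); apply: NK.
by apply: IHs => y ys; apply: sN; rewrite inE ys orbT.
Qed.

Lemma sub_sum_sup (I : Type) (D : set I) (N : I -> set M) i :
  D i -> N i `<=` sub_sum D N.
Proof.
move=> Di x Nx; exists [:: x]; last by rewrite big_seq1.
by move=> y; rewrite inE => /eqP ->; exists i.
Qed.

Lemma sub_sum0 (I : Type) (D : set I) (N : I -> set M) : sub_sum D N 0.
Proof. by exists [::]; rewrite ?big_nil. Qed.

Lemma sub_sumD (I : Type) (D : set I) (N : I -> set M) x y :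
  sub_sum D N x -> sub_sum D N y -> sub_sum D N (x + y).
Proof.
move=> [s sN <-] [t tN <-]; exists (s ++ t); last by rewrite big_cat.
by move=> z; rewrite mem_cat => /orP[]; [apply: sN|apply: tN].
Qed.

(** The sets [N i] and the target [P] need not be submodules, which allows sums
    of singletons and targets such as being zero or having a given image in a
    submodule. *)
Lemma sub_sum_ind (I : Type) (D : set I) (N : I -> set M) (P : M -> Prop) :
  P 0 -> (forall x y, P x -> P y -> P (x + y)) ->
  (forall i x, D i -> N i x -> P x) ->
  forall x, sub_sum D N x -> P x.
Proof.
move=> P0 PD PN _ [s sN <-]; elim: s sN => [|x s IHs] sN.
  by rewrite big_nil.
rewrite big_cons; apply: PD.
  by have [i] := sN x (mem_head _ _); apply: PN.
by apply: IHs => y ys; apply: sN; rewrite inE ys orbT.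
Qed.
End Submodules.

(** * Direct sums of copies of the module *)

Section Eval.
Variables (R : pzRingType) (M : lmodType R) (I : choiceType).
Variable F : I -> {linear M -> M}.

(** The homomorphism out of M^(I) given by its components [F]. The support of
    [i |-> F i (s i)] is finite, so that this iterated sum is an honest one. *)
Definition dsum_eval (s : dsum M I) : M := \sum_(i \in [set: I]) F i (s i).

Lemma dsum_finite (s : dsum M I) : finite_set [set i | s i != 0].
Proof. by case: s => s /= /asboolP. Qed.

Lemma dsum_evalE (s : dsum M I) (A : {fset I}) :
  [set i | s i != 0] `<=` [set` A] -> dsum_eval s = \sum_(i <- A) F i (s i).
Proof.
move=> sA; apply: fsbigTE => i; apply: contraNeq => Fsi.
by apply: sA => /=; apply: contraNneq Fsi => ->; rewrite linear0.
Qed.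

Lemma dsum_eval_linear : linear dsum_eval.
Proof.
move=> a s t.
(* Both sides become finite sums over one set that contains both supports. *)
have fin : finite_set ([set i | s i != 0] `|` [set i | t i != 0]).
  by rewrite finite_setU; split; apply: dsum_finite.
pose A := fset_set ([set i | s i != 0] `|` [set i | t i != 0]).
rewrite !(@dsum_evalE _ A) ?scaler_sumr -?big_split /=.
- by apply: eq_bigr => i _; rewrite -linearP.
- by rewrite fset_setK => // i; right.
- by rewrite fset_setK => // i; left.
rewrite fset_setK => // i /=.
rewrite [X in X != 0](_ : _ = a *: s i + t i) //.
case: (eqVneq (s i) 0) => [->|]; last by left.
by case: (eqVneq (t i) 0) => [->|]; [rewrite scaler0 addr0 eqxx|right].
Qed.

HB.instance Definition _ :=
  GRing.isLinear.Build R (dsum M I) M _ dsum_eval dsum_eval_linear.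

End Eval.

Section Single.
Variables (R : pzRingType) (M : lmodType R) (I : choiceType).

Lemma dsum_inj (s t : dsum M I) : s =1 t -> s = t.
Proof. by move=> st; apply: val_inj; apply/funext. Qed.

Lemma single_fin (i : I) (x : M) :
  (fun j => if j == i then x else 0) \in @fin_supp R M I.
Proof.
apply/asboolP; apply: sub_finite_set (finite_set1 i) => j /=.
by case: (eqVneq j i) => // _; rewrite eqxx.
Qed.

Definition dsum_single (i : I) (x : M) : dsum M I := DSum (single_fin i x).

Lemma dsum_single_linear i : linear (dsum_single i).
Proof.
move=> a x y; apply: dsum_inj => j.
rewrite [RHS](_ : _ = a *: dsum_single i x j + dsum_single i y j) //.
by rewrite /=; case: eqP => // _; rewrite scaler0 addr0.
Qed.

HB.instance Definition _ i :=
  GRing.isLinear.Build R M (dsum M I) _ (dsum_single i) (dsum_single_linear i).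

Definition dsum_proj (i : I) (s : dsum M I) : M := s i.

Lemma dsum_proj_linear i : linear (dsum_proj i).
Proof. by []. Qed.

HB.instance Definition _ i :=
  GRing.isLinear.Build R (dsum M I) M _ (dsum_proj i) (dsum_proj_linear i).

Lemma dsum_decomp (s : dsum M I) :
  s = \sum_(i <- fset_set [set i | s i != 0]) dsum_single i (s i).
Proof.
apply: dsum_inj => j; rewrite -!/(dsum_proj j _) raddf_sum /=.
rewrite /dsum_proj /=.
have [sj|sj] := eqVneq (s j) 0.
  by rewrite sj big1 // => i _; case: eqP => // <-.
have jA : j \in fset_set [set i | s i != 0].
  by rewrite in_fset_set ?inE //; apply: dsum_finite.
rewrite (bigD1_seq j) //= eqxx big1 ?addr0 // => i.
by rewrite eq_sym => /negPf ->.
Qed.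

Lemma dsum_eval_single (F : I -> {linear M -> M}) i x :
  dsum_eval F (dsum_single i x) = F i x.
Proof.
rewrite (@dsum_evalE _ _ _ _ _ [fset i]%fset) ?big_seq_fset1 /= ?eqxx //.
by move=> j /=; case: (eqVneq j i) => [->|]; rewrite ?eqxx // inE.
Qed.
End Single.

(** * Submodules generated by the module *)

Section Generation.
Variables (R : pzRingType) (M : lmodType R).
Implicit Types (K L N A B C : set M) (x y m : M).

Lemma range_submod (U V : lmodType R) (f : {linear U -> V}) :
  is_submodule (range f).
Proof.
apply/is_submoduleP; split; first by exists 0; rewrite ?linear0.
by move=> a _ _ [x _ <-] [y _ <-]; exists (a *: x + y); rewrite ?linearP.
Qed.

Lemma sub_sum_submod (I : Type) (D : set I) (N : I -> set M) :
  (forall i, D i -> is_submodule (N i)) -> is_submodule (sub_sum D N).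
Proof.
move=> subN; apply/is_submoduleP; split; first exact: sub_sum0.
move=> a x y Nx Ny; apply: sub_sumD => //.
apply: (sub_sum_ind (P := fun x => sub_sum D N (a *: x))) Nx.
- by rewrite scaler0; apply: sub_sum0.
- by move=> u v au av; rewrite scalerDr; apply: sub_sumD.
- move=> i u Di Nu; apply: (sub_sum_sup Di).
  by apply: submodZ => //; apply: subN.
Qed.

(** Being a quotient of some M^(X) turns into a condition on homomorphisms from
    M alone: restrict the presentation to each summand. *)
Lemma generated_trace K : generated_by K ->
  K `<=` sub_sum (hom_into K) (fun h : {linear M -> M} => range h).
Proof.
(* The index type carries no decidable equality; [classic] provides one. *)
move=> [X' [p' <-]]; pose X := {classic X'}.
move: p'; change X' with (X : Type) => p _ [s _ <-].
rewrite [s]dsum_decomp raddf_sum /=.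
apply: (big_ind (sub_sum _ _)); [exact: sub_sum0|exact: sub_sumD|move=> i _].
pose h : {linear M -> M} := p \o dsum_single i.
apply: (@sub_sum_sup _ _ _ _ _ h); last by exists (s i).
by move=> _ [x _ <-]; exists (dsum_single i x).
Qed.
End Generation.

(** * Lifting along sums of images *)

(** A submodule as a module of its own; the closure proof is a parameter of the
    type so that the module structure can be inferred from the type. *)
Record submod_type (R : pzRingType) (M : lmodType R) (K : set M)
  (subK : is_submodule K) := SubmodType {
  submod_val :> M;
  _ : submod_val \in K
}.

Section SubmoduleType.
Variables (R : pzRingType) (M : lmodType R) (K : set M) (subK : is_submodule K).

HB.instance Definition _ := [isSub for @submod_val R M K subK].
HB.instance Definition _ := [Choice of submod_type subK by <:].
HB.instance Definition _ :=
  GRing.SubChoice_isSubLmodule.Build R M (mem K) (submod_type subK)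
    (subK : submod_closed (mem K)).

Variables (U : lmodType R) (g : {linear U -> M}) (gK : range g `<=` K).

Definition corestr (u : U) : submod_type subK :=
  SubmodType subK (mem_set (gK (imageT g u))).

Lemma corestr_linear : linear corestr.
Proof. by move=> a u v; apply: val_inj; rewrite /= linearP. Qed.

HB.instance Definition _ :=
  GRing.isLinear.Build R U (submod_type subK) _ corestr corestr_linear.

Lemma corestr_onto : K `<=` range g -> range corestr = setT.
Proof.
move=> Kg; apply/seteqP; split=> // -[x xK] _.
have [u _ gu] := Kg x (set_mem xK).
by exists u => //; apply: val_inj.
Qed.

End SubmoduleType.

Section Lifting.
Variables (R : pzRingType) (M : lmodType R).
Implicit Types (K L N A B C : set M) (x y m : M).

Lemma in_sigma_dsum (X : Type) : in_sigma M (dsum M X).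
Proof.
exists X, (dsum M X), idfun, idfun; split; last exact: inj_id.
by apply/seteqP; split=> // s _; exists s.
Qed.

(** The only place where projectivity in sigma[M] enters. Pointwise, [f] factors
    through the family [H]: the canonical map from the direct sum of copies of
    M indexed by [H] onto the sum of the images is an epimorphism whose source
    lies in sigma[M], and the components of a lift of [f] are the maps [b].
    The number of nonzero terms depends on [x] since M is not assumed to be
    finitely generated. *)
Lemma lift_sum (H : set {linear M -> M}) (f : {linear M -> M}) :
  projective_in_sigma M ->
  range f `<=` sub_sum H (fun h : {linear M -> M} => range h) ->
  forall x, sub_sum H (fun h : {linear M -> M} =>
    [set h (b x) | b in [set: {linear M -> M}]]) (f x).
Proof.
move=> Mproj; set K := sub_sum H _ => fK x.
have subK : is_submodule K by apply: sub_sum_submod => h _; apply: range_submod.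
pose I := {classic {h | H h}}; pose F (i : I) := sval (i : {h | H h}).
have FH i : H (F i) by case: i.
have evalK : range (dsum_eval F) `<=` K.
  move=> _ [s _ <-]; rewrite [s]dsum_decomp raddf_sum /=.
  apply: (big_ind K) => [|u v|i _]; first exact: sub_sum0.
    exact: sub_sumD.
  by rewrite dsum_eval_single; apply: (sub_sum_sup (FH i)); exists (s i).
have Keval : K `<=` range (dsum_eval F).
  apply: sub_sum_least; first exact: range_submod.
  move=> h Hh _ [u _ <-]; exists (dsum_single (exist _ h Hh : I) u) => //.
  by rewrite dsum_eval_single.
have [b bP] := Mproj _ (in_sigma_dsum I) _ (corestr subK evalK) (corestr subK fK)
  (corestr_onto subK evalK Keval).
have /= <- := congr1 val (bP x).
rewrite [b x]dsum_decomp raddf_sum /=.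
apply: big_ind => [|u v|i _]; [exact: sub_sum0|exact: sub_sumD|].
rewrite dsum_eval_single; apply: (sub_sum_sup (FH i)).
by exists (dsum_proj i \o b).
Qed.
End Lifting.
(** * The lattice of fully invariant submodules *)

Section FullyInvariant.
Variables (R : pzRingType) (M : lmodType R).
Implicit Types (K L N A B C : set M) (x y m : M) (D : set (set M)).

Definition directed D := D !=set0 /\
  forall X Y, D X -> D Y -> exists Z, [/\ D Z, X `<=` Z & Y `<=` Z].

Lemma Lfi_submod K : Lfi K -> is_submodule K. Proof. by case. Qed.

Lemma Lfi_stable K (f : {linear M -> M}) x : Lfi K -> K x -> K (f x).
Proof. by case=> _ Kf Kx; apply: (Kf f); exists x. Qed.

Lemma Lfi_setT : Lfi [set: M].
Proof. by split=> //; apply/is_submoduleP. Qed.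

Lemma Lfi_0 : Lfi [set 0 : M].
Proof.
split; last by move=> f _ [_ -> <-]; rewrite linear0.
by apply/is_submoduleP; split=> // a x y /= -> ->; rewrite scaler0 addr0.
Qed.

Lemma Lfi_bigcap (I : Type) (D : set I) (N : I -> set M) :
  (forall i, D i -> Lfi (N i)) -> Lfi (\bigcap_(i in D) N i).
Proof.
move=> fiN; split.
  apply/is_submoduleP; split=> [i /fiN/Lfi_submod/submod0 //|a x y Nx Ny i Di].
  have /Lfi_submod subN := fiN i Di.
  by apply: submodD => //; [apply: submodZ => //; apply: Nx|apply: Ny].
by move=> f _ [x Nx <-] i Di; apply: Lfi_stable (Nx i Di); apply: fiN.
Qed.

Lemma Lfi_setI K L : Lfi K -> Lfi L -> Lfi (K `&` L).
Proof.
move=> fiK fiL; rewrite (_ : K `&` L = \bigcap_(b in [set: bool]) if b then K else L).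
  by apply: Lfi_bigcap => -[].
apply/seteqP; split=> [x [Kx Lx] []//|x KLx].
by split; [apply: (KLx true)|apply: (KLx false)].
Qed.

Lemma Lfi_sum (I : Type) (D : set I) (N : I -> set M) :
  (forall i, D i -> Lfi (N i)) -> Lfi (sub_sum D N).
Proof.
move=> fiN; split; first by apply: sub_sum_submod => i /fiN/Lfi_submod.
move=> f _ [x Nx <-].
apply: (sub_sum_ind (P := fun x => sub_sum D N (f x))) Nx.
- by rewrite linear0; apply: sub_sum0.
- by move=> u v fu fv; rewrite linearD; apply: sub_sumD.
- by move=> i u Di Nu; apply: (sub_sum_sup Di); apply: Lfi_stable Nu; apply: fiN.
Qed.

(** Binary sums as indexed sums, so that results on the latter apply. *)
Lemma sub_addE K L : is_submodule K -> is_submodule L ->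
  sub_add K L = sub_sum [set: bool] (fun b => if b then K else L).
Proof.
move=> subK subL; apply/seteqP; split=> [_ [x Kx] [y Ly] <-|].
  by apply: sub_sumD; [apply: (@sub_sum_sup _ _ _ _ _ true)
                      |apply: (@sub_sum_sup _ _ _ _ _ false)].
move=> x; apply: sub_sum_ind.
- by exists 0; [apply: submod0|exists 0; [apply: submod0|rewrite addr0]].
- move=> _ _ [x1 Kx1] [y1 Ly1] <- [x2 Kx2] [y2 Ly2] <-.
  exists (x1 + x2); first exact: submodD.
  by exists (y1 + y2); [apply: submodD|rewrite addrACA].
- case=> u _ uKL; first by exists u => //; exists 0; [apply: submod0|rewrite addr0].
  by exists 0; [apply: submod0|exists u => //; rewrite add0r].
Qed.

Lemma Lfi_add K L : Lfi K -> Lfi L -> Lfi (sub_add K L).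
Proof.
move=> fiK fiL; rewrite sub_addE; try exact: Lfi_submod.
by apply: Lfi_sum => -[].
Qed.

Lemma sub_addl K L : Lfi L -> K `<=` sub_add K L.
Proof.
move=> /Lfi_submod/submod0 L0 x Kx.
by exists x => //; exists 0; rewrite ?addr0.
Qed.

Lemma sub_addr K L : Lfi K -> L `<=` sub_add K L.
Proof.
move=> /Lfi_submod/submod0 K0 x Kx.
by exists 0 => //; exists x; rewrite ?add0r.
Qed.

Lemma sub_add_least K L A : Lfi A -> K `<=` A -> L `<=` A -> sub_add K L `<=` A.
Proof.
move=> /Lfi_submod subA KA LA _ [x Kx] [y Ly] <-.
by apply: submodD; [|apply: KA|apply: LA].
Qed.

Lemma sub_addS K L A B : K `<=` A -> L `<=` B -> sub_add K L `<=` sub_add A B.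
Proof.
by move=> KA LB _ [x Kx] [y Ly] <-; exists x; [apply: KA|exists y; [apply: LB|]].
Qed.

Lemma sub_addC K L : sub_add K L = sub_add L K.
Proof.
by apply/seteqP; split=> _ [x Kx] [y Ly] <-; exists y => //; exists x;
  rewrite // addrC.
Qed.

Lemma sub_add_setT K L A B : K `<=` A -> L `<=` B ->
  sub_add K L = setT -> sub_add A B = setT.
Proof.
by move=> KA LB KL; apply/seteqP; split=> // x _; apply: (sub_addS KA LB); rewrite KL.
Qed.

Lemma sub_add_max K L A : Lfi A -> sub_add K L = setT -> K `<=` A -> L `<=` A ->
  A = setT.
Proof.
by move=> fiA KL KA LA; apply/seteqP; split=> // x _;
  apply: (sub_add_least fiA KA LA); rewrite KL.
Qed.

(** A finite sum of elements of a directed family takes place in one member. *)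
Lemma directed_sum D : directed D -> D `<=` @Lfi R M ->
  sub_sum D id = \bigcup_(X in D) X.
Proof.
move=> [[X0 DX0] dirD] fiD; apply/seteqP; split; last first.
  by move=> x [X DX Xx]; apply: (sub_sum_sup DX).
apply: sub_sum_ind => [|x y [X DX Xx] [Y DY Yy]|X x DX Xx]; last by exists X.
  by exists X0 => //; apply: submod0; apply: Lfi_submod; apply: fiD.
have [Z [DZ XZ YZ]] := dirD X Y DX DY.
exists Z => //; apply: submodD; [exact/Lfi_submod/fiD|exact: XZ|exact: YZ].
Qed.

(** Joins and meets of fully invariant submodules are computed in the lattice of
    all submodules and inherit its laws: the modular law by subtracting an
    element of A, upper continuity by [directed_sum]. *)
Lemma Lfi_is_idiom : Lfi_idiom M.
Proof.
split=> [I N fiN|A B C fiA fiB fiC AC|A D fiA fiD D0 dirD].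
- by split; [apply: Lfi_sum|apply: Lfi_bigcap].
- have subC := Lfi_submod fiC.
  apply/seteqP; split.
    move=> _ [[a Aa] [b Bb] <- Cab]; exists a => //; exists b => //; split=> //.
    have -> : b = (a + b) - a by rewrite addrC addKr.
    by apply: submodB => //; apply: AC.
  move=> _ [a Aa] [b [Bb Cb]] <-; split; first by exists a => //; exists b.
  by apply: submodD => //; apply: AC.
- apply/seteqP; split.
    rewrite (directed_sum (conj D0 dirD) fiD) => x [Ax [X DX Xx]].
    by apply: (@sub_sum_sup _ _ _ _ _ X).
  apply: sub_sum_least => [|X DX x [Ax Xx]].
    by apply/Lfi_submod/Lfi_setI => //; apply: Lfi_sum.
  by split=> //; apply: (@sub_sum_sup _ _ _ _ _ X).
Qed.

Lemma Lfi_ann K : Lfi (sub_ann K).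
Proof.
split.
  apply/is_submoduleP; split=> [f _ /=|a x y ax ay f fK /=]; first exact: linear0.
  by rewrite linearP (ax f fK) (ay f fK) scaler0 addr0.
move=> g _ [x ax <-] f fK.
apply: (ax (f \o g : {linear M -> M})) => _ [u _ <-].
by apply: fK; exists (g u).
Qed.

Lemma sub_annS K L : K `<=` L -> sub_ann L `<=` sub_ann K.
Proof. by move=> KL x ax f fK; apply: ax => u /fK/KL. Qed.

(** Reduces all conditions on products to conditions on annihilators. *)
Lemma sub_prod_eq0 K L : sub_prod K L = [set 0] <-> K `<=` sub_ann L.
Proof.
split=> [KL0 x Kx f fL|KL0].
  have : sub_prod K L (f x) by apply: (sub_sum_sup fL); exists x.
  by rewrite KL0.
apply/seteqP; split=> [|_ ->]; last exact: sub_sum0.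
apply: sub_sum_least; first exact: (Lfi_submod Lfi_0).
by move=> f fL _ [x Kx <-]; apply: KL0 fL.
Qed.

Lemma cyclic_sub_submod m : is_submodule (cyclic_sub m).
Proof.
apply/is_submoduleP; split; first by exists 0; rewrite ?scale0r.
move=> a _ _ [b _ <-] [c _ <-]; exists (a * b + c) => //.
by rewrite scalerDl scalerA.
Qed.

Lemma mem_cyclic_sub m : cyclic_sub m m.
Proof. by exists 1; rewrite ?scale1r. Qed.

Lemma cyclic_sub_least m K : is_submodule K -> K m -> cyclic_sub m `<=` K.
Proof. by move=> subK Km _ [a _ <-]; apply: submodZ. Qed.

Definition fi_closure K : set M :=
  sub_sum setT (fun g : {linear M -> M} => g @` K).

Lemma sub_fi_closure K : K `<=` fi_closure K.
Proof.
by move=> x Kx; apply: (@sub_sum_sup _ _ _ _ _ (idfun : {linear M -> M})) => //; exists x.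
Qed.

Lemma Lfi_closure K : is_submodule K -> Lfi (fi_closure K).
Proof.
move=> subK; split.
  apply: sub_sum_submod => g _; apply/is_submoduleP; split.
    by exists 0; [apply: submod0|rewrite linear0].
  move=> a _ _ [x Kx <-] [y Ky <-]; exists (a *: x + y); last by rewrite linearP.
  by apply: submodD => //; apply: submodZ.
move=> f _ [x Kx <-].
apply: (sub_sum_ind (P := fun x => fi_closure K (f x))) Kx.
- by rewrite linear0; apply: sub_sum0.
- by move=> u v fu fv; rewrite linearD; apply: sub_sumD.
- move=> g _ _ [u Ku <-].
  by apply: (@sub_sum_sup _ _ _ _ _ (f \o g : {linear M -> M})) => //; exists u.
Qed.
End FullyInvariant.

(** * Annihilators and comaximality over a self-progenerator *)

Section Progenerator.
Variables (R : pzRingType) (M : lmodType R).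
Hypothesis Mpro : self_progenerator M.
Implicit Types (K L N A B C : set M) (x y m : M) (D : set (set M)).

Lemma trace_sup K : is_submodule K ->
  K `<=` sub_sum (hom_into K) (fun h : {linear M -> M} => range h).
Proof. by move=> /Mpro.2; apply: generated_trace. Qed.

Lemma hom_into_comp K (h : {linear M -> M}) (b : {linear M -> M}) :
  hom_into K h -> hom_into K (h \o b : {linear M -> M}).
Proof. by move=> hK _ [u _ <-]; apply: hK; exists (b u). Qed.

(** The form of [lift_sum] for sums of submodules: each summand is the sum of the
    images of the maps from M into it, and composing such a map with an
    endomorphism gives another such map. *)
Lemma lift_sub_sum (I : Type) (D : set I) (N : I -> set M) (f : {linear M -> M}) :
  (forall i, D i -> is_submodule (N i)) -> range f `<=` sub_sum D N ->
  forall x, sub_sum (\bigcup_(i in D) hom_into (N i))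
    (fun h : {linear M -> M} => [set h x]) (f x).
Proof.
move=> subN fN x; set H := \bigcup_(i in D) hom_into (N i).
have fH : range f `<=` sub_sum H (fun h : {linear M -> M} => range h).
  apply: subset_trans fN _; apply: sub_sum_least.
    by apply: sub_sum_submod => h _; apply: range_submod.
  move=> i Di; apply: subset_trans (trace_sup (subN i Di)) _.
  apply: sub_sum_least; first by apply: sub_sum_submod => h _; apply: range_submod.
  move=> h hN; apply: (@sub_sum_sup _ _ _ H (fun h : {linear M -> M} => range h)).
  by exists i.
apply: sub_sum_ind (lift_sum Mpro.1 fH x) => [|u v|h _ [i Di hN] [b _ <-]].
- exact: sub_sum0.
- exact: sub_sumD.
- apply: (@sub_sum_sup _ _ _ _ _ (h \o b : {linear M -> M})) => //.
  by exists i => //; apply: hom_into_comp.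
Qed.

Lemma sub_ann_sum (I : Type) (D : set I) (N : I -> set M) :
  (forall i, D i -> is_submodule (N i)) ->
  \bigcap_(i in D) sub_ann (N i) `<=` sub_ann (sub_sum D N).
Proof.
move=> subN x xN f fN /=.
apply: (sub_sum_ind (P := fun y => y = 0)) (lift_sub_sum subN fN x) => //.
  by move=> _ _ -> ->; rewrite addr0.
by move=> h _ [i Di hN] ->; apply: xN hN.
Qed.

Lemma sub_ann_add K L : is_submodule K -> is_submodule L ->
  sub_ann K `&` sub_ann L `<=` sub_ann (sub_add K L).
Proof.
move=> subK subL x [Kx Lx]; rewrite sub_addE //.
by apply: sub_ann_sum => -[].
Qed.

(** This holds because a map M -> g(K) lifts, pointwise, through g and maps
    M -> K, all of which kill Ann(K). *)
Lemma sub_ann_image K (g : {linear M -> M}) : is_submodule K ->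
  sub_ann K `<=` sub_ann (g @` K).
Proof.
move=> subK x xK f fK /=.
pose H := [set (g \o h : {linear M -> M}) | h in hom_into K].
have fH : range f `<=` sub_sum H (fun h : {linear M -> M} => range h).
  move=> y /fK [z Kz <-].
  apply: (sub_sum_ind (P := fun z => sub_sum H _ (g z))) (trace_sup subK Kz).
  - by rewrite linear0; apply: sub_sum0.
  - by move=> u v gu gv; rewrite linearD; apply: sub_sumD.
  - move=> h _ hK [u _ <-].
    by apply: (@sub_sum_sup _ _ _ _ _ (g \o h : {linear M -> M})); [exists h|exists u].
apply: (sub_sum_ind (P := fun y => y = 0)) (lift_sum Mpro.1 fH x) => //.
  by move=> _ _ -> ->; rewrite addr0.
move=> _ _ [h hK <-] [b _ <-] /=.
by have /= -> := xK _ (hom_into_comp (b := b) hK); rewrite linear0.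
Qed.

Lemma sub_ann_closure K : is_submodule K -> sub_ann K `<=` sub_ann (fi_closure K).
Proof.
move=> subK x xK; apply: sub_ann_sum => [g _|g _]; last exact: sub_ann_image.
apply/is_submoduleP; split.
  by exists 0; [apply: submod0|rewrite linear0].
move=> a _ _ [u Ku <-] [v Kv <-]; exists (a *: u + v); last by rewrite linearP.
by apply: submodD => //; apply: submodZ.
Qed.

(** The identity of M lifts through N + A, so every [b] in [B] is a sum of values
    [h b] with [h] into N or into A; those values remain in [B] by full
    invariance. This plays the role of multiplying comaximal ideals. *)
Lemma comaximal_setI N A B : Lfi N -> Lfi A -> Lfi B ->
  sub_add N A = setT -> sub_add N B = setT -> sub_add N (A `&` B) = setT.
Proof.
move=> fiN fiA fiB NA NB.
have fiAB := Lfi_setI fiA fiB.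
apply: (sub_add_max (Lfi_add fiN fiAB) NB); first exact: sub_addl.
move=> b Bb.
have idNA : range (idfun : {linear M -> M}) `<=`
    sub_sum setT (fun c : bool => if c then N else A).
  by rewrite -sub_addE ?NA //; apply: Lfi_submod.
have subNA (c : bool) : [set: bool] c -> is_submodule (if c then N else A).
  by case: c => _; apply: Lfi_submod.
apply: sub_sum_least (lift_sub_sum subNA idNA b).
  exact/Lfi_submod/Lfi_add.
move=> h [[] _ hNA] _ ->.
  by apply: sub_addl => //; apply: hNA; exists b.
apply: sub_addr => //; split; first by apply: hNA; exists b.
exact: Lfi_stable.
Qed.

(** * The operator Ler *)

Definition Ler_witness N : set (set M) :=
  [set C | Lfi C /\ sub_add N (sub_ann C) = setT].

Lemma Ler_witness_directed N : Lfi N -> directed (Ler_witness N).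
Proof.
move=> fiN; split.
  exists [set 0]; split; first exact: Lfi_0.
  apply/seteqP; split=> // x _; apply: sub_addr => // f f0 /=.
  by apply: f0; exists x.
move=> X Y [fiX NX] [fiY NY]; exists (sub_add X Y).
split; [|exact: sub_addl|exact: sub_addr]; split; first exact: Lfi_add.
have := comaximal_setI fiN (Lfi_ann X) (Lfi_ann Y) NX NY.
by apply: sub_add_setT => //; apply: sub_ann_add; apply: Lfi_submod.
Qed.

(** The element-wise definition of Ler only involves cyclic submodules Rm; these
    may be replaced by fully invariant ones since Rm and its fully invariant
    closure have the same annihilator. *)
Lemma LerE N : Lfi N -> Ler N = sub_sum (Ler_witness N) id.
Proof.
move=> fiN; rewrite directed_sum; [|exact: Ler_witness_directed|by move=> C []].
apply/seteqP; split=> [m Nm|m [C [fiC NC] Cm]].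
  have subm := cyclic_sub_submod m.
  exists (fi_closure (cyclic_sub m)); last first.
    by apply: sub_fi_closure; apply: mem_cyclic_sub.
  split; first exact: Lfi_closure.
  by apply: sub_add_setT Nm => //; apply: sub_ann_closure.
apply: sub_add_setT NC => //; apply: sub_annS.
by apply: cyclic_sub_least => //; apply: Lfi_submod.
Qed.

Lemma Lfi_Ler N : Lfi N -> Lfi (Ler N).
Proof. by move=> fiN; rewrite LerE //; apply: Lfi_sum => C []. Qed.

Lemma LerS N L : N `<=` L -> Ler N `<=` Ler L.
Proof. by move=> NL m; apply: sub_add_setT. Qed.

(** If x = n + a with n in N and a in Ann(Rm), then every map h from M to Rm
    sends x to h(n), which is in N; and m is a sum of such values. *)
Lemma Ler_sub N : Lfi N -> Ler N `<=` N.
Proof.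
move=> fiN m Nm.
apply: sub_sum_least (trace_sup (cyclic_sub_submod m) (mem_cyclic_sub m)).
  exact: Lfi_submod.
move=> h hm _ [x _ <-].
have : sub_add N (sub_ann (cyclic_sub m)) x by rewrite Nm.
case=> n Nn [a am <-]; rewrite linearD (am h hm) addr0.
exact: Lfi_stable.
Qed.

Lemma Ler_setT : Ler [set: M] = setT.
Proof.
apply/seteqP; split=> // m _; apply/seteqP; split=> // x _.
by apply: sub_addl => //; apply: Lfi_ann.
Qed.

(** * Maximal fully invariant submodules *)

Lemma maxfi_add Mx K : Maxfi Mx -> Lfi K -> ~ K `<=` Mx -> sub_add Mx K = setT.
Proof.
move=> [fiMx _ maxMx] fiK KMx.
have [MxK|//] := maxMx _ (Lfi_add fiMx fiK) (sub_addl fiK).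
by case: KMx; rewrite -MxK; apply: sub_addr.
Qed.

Lemma maxfi_setI Mx A B : Maxfi Mx -> Lfi A -> Lfi B ->
  A `&` B `<=` Mx -> A `<=` Mx \/ B `<=` Mx.
Proof.
move=> maxMx fiA fiB ABMx; have [fiMx MxT _] := maxMx.
have [AMx|AMx] := pselect (A `<=` Mx); first by left.
have [BMx|BMx] := pselect (B `<=` Mx); first by right.
case: MxT; apply: (sub_add_max (K := Mx) (L := A `&` B)) => //.
by apply: comaximal_setI => //; apply: maxfi_add.
Qed.
End Progenerator.

(** * Compactness *)

Section Compact.
Variables (R : pzRingType) (M : lmodType R).
Hypothesis M_compact : Lfi_compact M.
Implicit Types (K L N A B C : set M) (x y m : M) (D : set (set M)).

(** Compactness provides finitely many members [X] with the sum of the [B + X]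
    equal to M, and directedness bounds them by one member. *)
Lemma compact_directed B D : Lfi B -> D `<=` @Lfi R M -> directed D ->
  sub_add B (sub_sum D id) = setT -> exists2 X, D X & sub_add B X = setT.
Proof.
move=> fiB fiD [[X0 DX0] dirD] BD.
pose I := {classic {X | D X}}; pose N (i : I) := sub_add B (sval (i : {X | D X})).
have DI (i : I) : D (sval (i : {X | D X})) by case: i.
have fiN i : Lfi (N i) by apply: Lfi_add => //; apply: fiD.
have NT : sub_sum setT N = setT.
  apply: sub_add_max BD _ _; first exact: Lfi_sum.
    apply: subset_trans (@sub_sum_sup _ _ I _ _ (exist _ X0 DX0) _) => //.
    by apply: sub_addl; apply: fiD.
  apply: sub_sum_least; first exact/Lfi_submod/Lfi_sum.
  move=> X DX; apply: subset_trans (@sub_sum_sup _ _ I _ _ (exist _ X DX) _) => //.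
  exact: sub_addr.
have [F /finite_seqP[s ->] sT] := M_compact fiN NT.
have [Z DZ sZ] : exists2 Z, D Z & forall i, i \in s -> sval (i : {X | D X}) `<=` Z.
  elim: s {sT} => [|i s [Z DZ sZ]]; first by exists X0.
  have [Y [DY ZY iY]] := dirD _ _ DZ (DI i).
  exists Y => // j; rewrite inE => /orP[/eqP -> //|/sZ jZ].
  exact: subset_trans ZY.
exists Z => //; apply/seteqP; split=> // x _.
have fiZ := fiD _ DZ.
have : sub_sum [set` s] N x by rewrite sT.
apply: sub_sum_least; first exact/Lfi_submod/Lfi_add.
by move=> i /= /sZ iZ; apply: sub_addS.
Qed.

(** Zorn's lemma; by [compact_directed] the union of a chain of proper elements
    is proper. *)
Lemma maxfi_above A : Lfi A -> A <> setT -> exists2 Mx, Maxfi Mx & A `<=` Mx.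
Proof.
move=> fiA AT.
(* Zorn's lemma must also handle the empty chain, whose union is empty: hence
   the set-theoretic union with [A], which turns the empty set into [A]. *)
pose P X := Lfi (A `|` X) /\ A `|` X <> setT.
have [F FP totF|X [[fiX XT] maxX]] := @Zorn_bigcup M P.
  have [->|/set0P[X0 FX0]] := eqVneq F set0; first by rewrite /P bigcup_set0 setU0.
  pose D := [set A `|` X | X in F].
  have fiD : D `<=` @Lfi R M by move=> _ [X /FP[fiX _] <-].
  have dirD : directed D.
    split; first by exists (A `|` X0); exists X0.
    move=> _ _ [X FX <-] [Y FY <-]; have [XY|YX] := totF X Y FX FY.
      by exists (A `|` Y); split=> //; [exists Y|apply: setUS].
    by exists (A `|` X); split=> //; [exists X|apply: setUS].
  have -> : P (\bigcup_(X in F) X) =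
      (Lfi (sub_sum D id) /\ sub_sum D id <> setT).
    rewrite /P directed_sum // bigcup_image /= bigcupUr //; last by exists X0.
  split; first exact: Lfi_sum.
  move=> DT; have [|_ [X FX <-] AX] := compact_directed fiA fiD dirD.
    by apply/seteqP; split=> // x _; apply: sub_addr; rewrite ?DT.
  have [fiX []] := FP X FX.
  by apply: (sub_add_max fiX AX) => // x Ax; left.
exists (A `|` X); last by left.
split=> // K fiK XK; have [KX|KX] := pselect (K `<=` A `|` X).
  by left; apply/seteqP.
right; apply: contrapT => KT; apply: (maxX K).
  split=> [x Xx|KX']; first by apply: XK; right.
  by apply: KX => x /KX'; right.
by rewrite /P setUidr // => x Ax; apply: XK; left.
Qed.

Lemma eq_setT_maxfi A : Lfi A -> (forall Mx, Maxfi Mx -> ~ A `<=` Mx) -> A = setT.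
Proof.
move=> fiA Amax; apply: contrapT => /(maxfi_above fiA)[Mx maxMx AMx].
exact: Amax AMx.
Qed.
End Compact.

(** * The equivalent conditions *)

Section Conditions.
Variables (R : pzRingType) (M : lmodType R).
Hypotheses (Mpro : self_progenerator M) (M_compact : Lfi_compact M).
Implicit Types (K L N A B C Mx : set M) (x y m : M).

(** For given [A] and [B], a witness of normality is a [B'] with [A + B' = M] and
    [B + Ann(B') = M], the best [A'] being the annihilator of [B']. Such a [B']
    lies in Ler(B); conversely, as Ler(B) is a directed union of submodules with
    the second property, compactness extracts one of them with the first. *)
Lemma normal_Ler : Lfi_normal M <->
  (forall A B, Lfi A -> Lfi B -> sub_add A B = setT -> sub_add A (Ler B) = setT).
Proof.
split=> [Mnorm|LerP] A B fiA fiB AB.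
  have [A' [B' [fiA' fiB' AB' A'B /sub_prod_eq0 A'B'0]]] := Mnorm A B fiA fiB AB.
  apply: sub_add_setT AB' => //; rewrite LerE //; apply: sub_sum_sup.
  split=> //.
  by apply: (sub_add_setT _ A'B'0 (K := B)) => //; rewrite sub_addC.
have /[!LerE]// AB' := LerP A B fiA fiB AB.
have [|B' [fiB' BB'] {}AB'] :=
    compact_directed M_compact fiA _ (Ler_witness_directed Mpro fiB) AB'.
  by move=> C [].
exists (sub_ann B'), B'; split=> //; first exact: Lfi_ann.
  by rewrite sub_addC.
by apply/sub_prod_eq0.
Qed.

(** If A + Ler(B) were contained in a maximal N, the annihilators of the
    submodules outside N would form a directed family whose union, by strong
    harmonicity, is contained in no maximal L above B. *)
Lemma harmonic_normal : strongly_harmonic M -> Lfi_normal M.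
Proof.
move=> Mharm; apply/normal_Ler => A B fiA fiB AB.
have fiLB := Lfi_Ler Mpro fiB.
apply: (eq_setT_maxfi M_compact (Lfi_add fiA fiLB)) => N maxN ALN.
have [fiN NT _] := maxN.
have AN := subset_trans (sub_addl fiLB) ALN.
have LBN := subset_trans (sub_addr fiA) ALN.
pose D := [set sub_ann Y | Y in [set Y | Lfi Y /\ ~ Y `<=` N]].
have fiD : D `<=` @Lfi R M by move=> _ [Y _ <-]; apply: Lfi_ann.
have dirD : directed D.
  split.
    exists (sub_ann setT), setT => //; split; first exact: Lfi_setT.
    by move=> TN; apply: NT; apply/seteqP; split.
  move=> _ _ [X [fiX XN] <-] [Y [fiY YN] <-]; exists (sub_ann (X `&` Y)).
  split; [|apply: sub_annS => x []//|apply: sub_annS => x []//].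
  exists (X `&` Y) => //; split; first exact: Lfi_setI.
  (* Directedness is the primeness of [N]. *)
  by move=> /(maxfi_setI Mpro maxN fiX fiY)[].
have [|_ [Y [fiY YN] <-] BY] := compact_directed M_compact fiB fiD dirD.
  have fiS : Lfi (sub_sum D id) by apply: Lfi_sum.
  apply: (eq_setT_maxfi M_compact (Lfi_add fiB fiS)) => L maxL BSL.
  have [fiL LT _] := maxL.
  have BL := subset_trans (sub_addl fiS) BSL.
  have SL := subset_trans (sub_addr fiB) BSL.
  have NL : N <> L.
    by move=> NL; apply: NT; apply: sub_add_max AB _ _; rewrite // NL.
  have [N' [L' [fiN' fiL' L'L N'N /sub_prod_eq0 L'N']]] := Mharm N L maxN maxL NL.
  apply: L'L; apply: subset_trans L'N' _; apply: subset_trans SL.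
  by apply: (@sub_sum_sup _ _ _ D id); exists N'.
apply: YN; apply: subset_trans LBN; rewrite LerE //.
by apply: (@sub_sum_sup _ _ _ _ id).
Qed.

Lemma normal_maxfi N Mx : Lfi_normal M -> Lfi N -> Maxfi Mx ->
  Ler N `<=` Mx <-> N `<=` Mx.
Proof.
move=> /normal_Ler Mnorm fiN maxMx; split; last first.
  by apply: subset_trans; apply: Ler_sub.
move=> LN; apply: contrapT => NMx; have [fiMx MxT _] := maxMx.
apply: MxT; apply: (sub_add_max (K := Mx) (L := Ler N)) => //.
by apply: Mnorm => //; apply: maxfi_add.
Qed.

(** An element m of Ler(sum N_i) satisfies sum N_i + Ann(Rm) = M; the hypothesis
    on maximal elements allows N_i to be replaced by Ler(N_i) there. This says
    that m is in Ler(sum Ler(N_i)), and Ler decreases submodules. *)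
Lemma maxfi_Ler_sum :
  (forall N Mx, Lfi N -> Maxfi Mx -> (Ler N `<=` Mx <-> N `<=` Mx)) ->
  Ler_sum_preserving M.
Proof.
move=> LerMx I N fiN.
have fiS : Lfi (sub_sum setT N) by apply: Lfi_sum.
have fiLS : Lfi (sub_sum setT (fun i => Ler (N i))).
  by apply: Lfi_sum => i _; apply: Lfi_Ler.
apply/seteqP; split=> [m mS|]; last first.
  apply: sub_sum_least => [|i _]; first exact/Lfi_submod/Lfi_Ler.
  by apply: LerS; apply: sub_sum_sup.
apply: (Ler_sub Mpro fiLS).
have fim := Lfi_ann (cyclic_sub m).
apply: (eq_setT_maxfi M_compact (Lfi_add fiLS fim)) => Mx maxMx KMx.
have [fiMx MxT _] := maxMx.
apply: MxT; apply: (sub_add_max fiMx mS); last first.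
  exact: subset_trans (sub_addr fiLS) KMx.
apply: sub_sum_least => [|i _]; first exact: Lfi_submod.
apply/(LerMx _ _ (fiN i) maxMx); apply: subset_trans KMx.
apply: subset_trans (sub_addl fim).
exact: (@sub_sum_sup _ _ _ _ (fun i => Ler (N i))).
Qed.

Lemma Ler_sum_adjoint : Ler_sum_preserving M -> Ler_has_right_adjoint M.
Proof.
move=> LerD; pose I K := {N : set M | Lfi N /\ Ler N `<=` K}.
pose G K := sub_sum [set: I K] (fun i => sval i).
have fiI K (i : I K) : Lfi (sval i) by case: i => N [].
exists G => [K fiK|N K fiN fiK]; first exact: Lfi_sum.
split=> [NK|NG].
  exact: (@sub_sum_sup _ _ (I K) _ (fun i => sval i)
            (exist _ N (conj fiN NK))).
apply: subset_trans (LerS NG) _; rewrite LerD //.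
apply: sub_sum_least => [|[L [fiL LK]] _ //]; exact: Lfi_submod.
Qed.

Lemma adjoint_comaximal N L : Ler_has_right_adjoint M -> Lfi N -> Lfi L ->
  sub_add N L = setT -> sub_add (Ler N) (Ler L) = setT.
Proof.
move=> [G fiG adjG] fiN fiL NL.
have [fiLN fiLL] := (Lfi_Ler Mpro fiN, Lfi_Ler Mpro fiL).
have fiK := Lfi_add fiLN fiLL.
apply/seteqP; split=> //; rewrite -{1}(@Ler_setT R M).
apply/(adjG _ _ (@Lfi_setT R M) fiK).
rewrite -NL; apply: sub_add_least; first exact: fiG.
  by apply/(adjG _ _ fiN fiK); apply: sub_addl.
by apply/(adjG _ _ fiL fiK); apply: sub_addr.
Qed.

(** As Ler(N) is contained in N, having Ler(L) in N as well would contradict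
    Ler(N) + Ler(L) = M. A witness C of Ler(L) outside N is then annihilated by
    Ann(C), which is outside L since L + Ann(C) = M. *)
Lemma comaximal_harmonic :
  (forall N L, Lfi N -> Lfi L ->
     sub_add N L = setT -> sub_add (Ler N) (Ler L) = setT) ->
  strongly_harmonic M.
Proof.
move=> LerNL N L maxN maxL NL.
have [fiN NT _] := maxN; have [fiL LT topL] := maxL.
have NLT : sub_add N L = setT.
  apply: maxfi_add => // LN.
  by have [|] := topL N fiN LN.
have [LLN|LLN] := pselect (Ler L `<=` N).
  case: NT; apply: (sub_add_max fiN (LerNL N L fiN fiL NLT)) => //.
  exact: Ler_sub.
move: LLN; rewrite LerE // => LLN.
have [C [fiC LC] CN] : exists2 C, Ler_witness L C & ~ C `<=` N.
  apply: contrapT => noC; apply: LLN; apply: sub_sum_least.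
    exact: Lfi_submod.
  by move=> C LC; apply: contrapT => CN; apply: noC; exists C.
exists C, (sub_ann C); split=> //; first exact: Lfi_ann.
  by move=> CL; apply: LT; apply: sub_add_max LC _ _.
exact/sub_prod_eq0.
Qed.
End Conditions.

Theorem theorem4p21 (R : pzRingType) (M : lmodType R)
    (M_progen : self_progenerator M) (M_compact : Lfi_compact M) :
  [<-> (* a *) strongly_harmonic M;
       (* b *) Lfi_idiom M /\ Lfi_normal M;
       (* c *) forall N Mx : set M, Lfi N -> Maxfi Mx ->
                 (Ler N `<=` Mx <-> N `<=` Mx);
       (* d *) Ler_sum_preserving M;
       Ler_has_right_adjoint M;
       (* e *) forall N L : set M, Lfi N -> Lfi L ->
                 sub_add N L = setT -> sub_add (Ler N) (Ler L) = setT].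
Proof.
tfae.
- by move=> Mharm; split; [apply: Lfi_is_idiom|apply: harmonic_normal].
- by case=> _ Mnorm N Mx; apply: normal_maxfi.
- exact: maxfi_Ler_sum.
- exact: Ler_sum_adjoint.
- by move=> Madj N L; apply: adjoint_comaximal.
- exact: comaximal_harmonic.
Qed.
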